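(* There exists an oriented percolation game on $\mathbb{Z}^3$, with payoffs in $\{0,1\}$, such that for all $z\in\mathbb{Z}^3$, $\mathbb{P}$-almost surely, $$\limsup_{n\to+\infty}v_n(z)=1\quad\text{and}\quad \liminf_{n\to+\infty}v_n(z)=0.$$
   Context: A percolation game on $\mathbb{Z}^d$ ($d\ge1$; here $d=3$) is a tuple $\Gamma=(I,J,\Omega,g,q)$ where: - $I$ and $J$ are finite nonempty sets (the action sets of Player 1 and Player 2). - $(\Omega,\mathcal{F},\mathbb{P})$ is a probability space equipped with measurable transformations $\tau_z:\Omega\to\Omega$, $z\in\mathbb{Z}^d$, such that for all $z,z'\in\mathbb{Z}^d$ and $F\in\mathcal{F}$, $\mathbb{P}(\tau_z(F))=\mathbb{P}(F)$ and $\tau_{z+z'}=\tau_z\circ\tau_{z'}$. Moreover the family is ergodic: if $F\in\mathcal{F}$ satisfies $\tau_z(F)=F$ for all $z\in\mathbb{Z}^d$, then $\mathbb{P}(F)\in\{0,1\}$. - $g=(\omega\mapsto g_\omega(z,i,j))_{(z,i,j)\in\mathbb{Z}^d\times I\times J}$ is a collection of real-valued random variables on $\Omega$, uniformly bounded and stationary: $g_{\tau_z(\omega)}(z',i,j)=g_\omega(z+z',i,j)$ for all $z,z'\in\mathbb{Z}^d$, $i\in I$, $j\in J$, $\omega\in\Omega$. ''Payoffs in $\{0,1\}$'' means that $g_\omega(z,i,j)\in\{0,1\}$ always. - $q:I\times J\to\mathbb{Z}^d$ is the transition function. Given an initial state $z_1=z\in\mathbb{Z}^d$ and $\omega\in\Omega$,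 the players are informed of $\omega$. At each stage $m\ge1$, Player 1 chooses $i_m\in I$; then, knowing $i_m$, Player 2 chooses $j_m\in J$; Player 1 receives $g_\omega(z_m,i_m,j_m)$ and Player 2 receives $-g_\omega(z_m,i_m,j_m)$; the new state is $z_{m+1}=z_m+q(i_m,j_m)$. A strategy of Player 1 is a collection $\sigma$ of mappings $\sigma_m:(\mathbb{Z}^d\times I\times J)^{m-1}\times\mathbb{Z}^d\to I$, $m\ge1$; a strategy of Player 2 is a collection $\rho$ of mappings $\rho_m:(\mathbb{Z}^d\times I\times J)^{m-1}\times\mathbb{Z}^d\times I\to J$, $m\ge1$. Let $\Sigma$ and $T$ be the corresponding strategy sets. An initial state $z$ and a pair $(\sigma,\rho)\in\Sigma\times T$ induce a sequence $(z_m,i_m,j_m)_{m\ge1}$, and the $n$-stage payoff is $$\gamma_n^\omega(z,\sigma,\rho)=\frac1n\sum_{m=1}^n g_\omega(z_m,i_m,j_m).$$ The value of the $n$-stage game is $$v_n^\omega(z)=\max_{\sigma\in\Sigma}\min_{\rho\in T}\gamma_n^\omega(z,\sigma,\rho)=\min_{\rho\in T}\max_{\sigma\in\Sigma}\gamma_n^\omega(z,\sigma,\rho),$$ and $v_n(z)$ denotes the random variable $\omega\mapsto v_n^\omega(z)$. The game is oriented if there exists $u\in\mathbb{Z}^d$ such that $q(i,j)\cdot u>0$ for all $(i,j)\in I\times J$. *)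

(* Defs.v *)
From HB Require Import structures.
From mathcomp Require Import all_boot all_order all_algebra.
From mathcomp Require Import all_classical all_reals all_analysis.
Set Implicit Arguments.
Unset Strict Implicit.
Unset Printing Implicit Defensive.
Import Order.TTheory GRing.Theory Num.Theory.
Import numFieldNormedType.Exports.

Local Open Scope classical_set_scope.
Local Open Scope ring_scope.

Record percolation_game (R : realType) (d : nat) := PercolationGame {
  act1 : finType;
  act2 : finType;
  act1_gt0 : (0 < #|act1|)%N;
  act2_gt0 : (0 < #|act2|)%N;
  disp : measure_display;
  Omega : measurableType disp;
  Pr : probability Omega R;
  tau : 'rV[int]_d -> Omega -> Omega;
  tau_measurable : forall z, measurable_fun [set: Omega] (tau z);
  (* [Pr] is a total function on sets, so that [Pr (tau z @` F)] is meaningful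
     is required separately. *)
  tau_image : forall z (F : set Omega), measurable F -> measurable (tau z @` F);
  tau_preserving : forall z (F : set Omega),
    measurable F -> Pr (tau z @` F) = Pr F;
  tauD : forall z z', tau (z + z') = tau z \o tau z';
  tau_ergodic : forall F : set Omega, measurable F ->
    (forall z, tau z @` F = F) -> Pr F = 0%E \/ Pr F = 1%E;
  payoff : Omega -> 'rV[int]_d -> act1 -> act2 -> R;
  payoff_measurable : forall z i j,
    measurable_fun [set: Omega] (fun w => payoff w z i j);
  payoff_bounded : exists M : R, forall w z i j, `|payoff w z i j| <= M;
  payoff_stationary : forall z z' i j w,
    payoff (tau z w) z' i j = payoff w (z + z') i j;
  trans : act1 -> act2 -> 'rV[int]_d }.

Section Game.
Variables (R : realType) (d : nat) (G : percolation_game R d).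

Definition step := ('rV[int]_d * act1 G * act2 G)%type.

(* Stages are numbered from 0: the index m is the length of the history. *)
Definition strategy1 := forall m : nat, m.-tuple step -> 'rV[int]_d -> act1 G.
Definition strategy2 :=
  forall m : nat, m.-tuple step -> 'rV[int]_d -> act1 G -> act2 G.

Section Play.
Variables (z : 'rV[int]_d) (s : strategy1) (r : strategy2).

Fixpoint play (m : nat) : m.-tuple step * 'rV[int]_d :=
  match m with
  | 0%N => ([tuple], z)
  | m'.+1 =>
      let: (h, zm) := play m' in
      let i := s h zm in
      let j := r h zm i in
      ([tuple of rcons h (zm, i, j)], zm + trans i j)
  end.

Definition state_at m := (play m).2.
Definition act1_at m := s (play m).1 (state_at m).
Definition act2_at m := r (play m).1 (state_at m) (act1_at m).

Definition mean_payoff (n : nat) (w : Omega G) : R :=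
  n%:R^-1 * \sum_(m < n) payoff w (state_at m) (act1_at m) (act2_at m).

End Play.

(* The n-stage payoff takes finitely many values as the strategies vary, hence
   [sup] and [inf] are here a maximum and a minimum. *)
Definition value (n : nat) (z : 'rV[int]_d) (w : Omega G) : R :=
  sup (range (fun s : strategy1 =>
    inf (range (fun r : strategy2 => mean_payoff z s r n w)))).

Definition oriented := exists u : 'rV[int]_d, forall i j,
  0 < \sum_(k < d) @trans R d G i j ord0 k * u ord0 k.

Definition payoffs01 := forall (w : Omega G) z i j,
  payoff w z i j = 0 \/ payoff w z i j = 1.

End Game.

(* Main.v *)
From HB Require Import structures.
Require Import Defs.
From mathcomp Require Import all_boot all_order all_algebra.
From mathcomp Require Import all_classical all_reals all_analysis.
From mathcomp Require Import measurable_realfun zify.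
Import Order.TTheory GRing.Theory Num.Theory.
Import numFieldNormedType.Exports.
Local Open Scope classical_set_scope.
Local Open Scope ring_scope.
Set Implicit Arguments.
Unset Strict Implicit.
Unset Printing Implicit Defensive.

(** Write the state as (x, y, t): Player 1 moves x by 0 or 1, Player 2 moves y
    by 0 or 1, and t, which the payoff ignores, increases by 1 at each stage.
    For each level k put parallel walls with spacing L_k at a uniform random
    offset modulo L_k, independently over k: walls {x = const} if k is even,
    {y = const} if k is odd. The payoff is 1 iff the highest level of a wall
    through the state exists and is even. The player who controls the
    coordinate of level k reaches a wall of level k in at most L_k stages and
    can stay on it forever. Since L_(k+1) is much larger than 2^k L_k,
    Borel-Cantelli shows that a.s. for all large k no wall of level above k is
    met during the first 2^k L_k stages; the value of the game of that length
    is then within 2^-k of 1 for even k and of 0 for odd k.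

    The spacings are pairwise coprime, so by the Chinese remainder theorem
    translations act transitively on the cylinders of each length, and this
    makes the product of the uniform measures on the Z/L_k ergodic. *)

(** * Digit sequences, cylinders and measurability *)

Section Digits.
(* Digits of rank k are residues modulo [(l k).+2], a shape for which MathComp
   has a ring structure on the ordinals. *)
Variable l : nat -> nat.

Definition digits := forall k, 'I_(l k).+2.

HB.instance Definition _ := gen_eqMixin digits.
HB.instance Definition _ := gen_choiceMixin digits.
HB.instance Definition _ := isPointed.Build digits (fun=> 0).

(** Encoding a prefix by a full sequence [c] avoids dependently typed finite words. *)
Definition cylinder n (c : digits) : set digits :=
  [set w | forall k, (k < n)%N -> w k = c k].

Definition cylinders : set (set digits) :=
  [set A | A = set0 \/ exists n c, A = cylinder n c].

Definition digit_space := g_sigma_algebraType cylinders.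
HB.instance Definition _ := Measurable.on digit_space.

Lemma cylinder0 c : cylinder 0 c = setT.
Proof. by apply/seteqP; split. Qed.

Lemma setI_cylinders : setI_closed cylinders.
Proof.
have cyl n m c c' : (n <= m)%N -> cylinders (cylinder n c `&` cylinder m c').
  move=> nm; have [cc'|ncc'] := pselect (cylinder n c c'); last first.
    left; rewrite -subset0 => w [wc wc']; apply: ncc' => k kn.
    by rewrite -wc'// ?wc// (leq_trans kn).
  right; exists m, c'; rewrite setIidr// => w wc' k kn.
  by rewrite wc' ?cc'// (leq_trans kn).
move=> A B [->|[n [c ->]]] [->|[m [c' ->]]]; rewrite ?set0I ?setI0; try by left.
by have [nm|/ltnW mn] := leqP n m; [|rewrite setIC]; exact: cyl.
Qed.

Lemma measurable_cylinder n c : measurable (cylinder n c : set digit_space).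
Proof. by apply: sub_sigma_algebra; right; exists n, c. Qed.

Lemma cylinderS n c : cylinder n c =
  \bigcup_(d in [set: 'I_(l n).+2]) cylinder n.+1 (dfwith c n d).
Proof.
apply/seteqP; split => [w wc|w [d _ wcd] k kn].
  exists (w n) => // k; rewrite ltnS leq_eqVlt => /predU1P[->|kn].
    by rewrite dfwithin.
  by rewrite dfwithout ?wc// gtn_eqF.
by rewrite wcd ?dfwithout ?gtn_eqF// ltnW.
Qed.

(** A cylinder of length [n] lies in [A] or misses it, and a shorter one is a finite union of
    cylinders one digit longer; the induction is on the number [q] of digits still free. *)
Lemma finitely_determined_measurable n (A : set digit_space) :
  (forall w w' : digits, cylinder n w w' -> A w -> A w') -> measurable A.
Proof.
move=> An; suff H q c : (q <= n)%N ->
    measurable (cylinder (n - q) c `&` A : set digit_space).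
  by rewrite -[A]setTI -(cylinder0 (fun=> 0)) -(subnn n); exact: H.
elim: q c => [|q IH] c qn.
  have [Ac|nAc] := pselect (A c).
    rewrite setIidl ?subn0; first exact: measurable_cylinder.
    by move=> w wc; exact: An wc Ac.
  rewrite [X in measurable X](_ : _ = set0)// -subset0 => w [wc Aw].
  by apply: nAc; apply: An Aw => k kn; rewrite wc// subn0.
rewrite cylinderS setI_bigcupl; apply: fin_bigcup_measurable => // d _.
by rewrite subnSK//; apply: IH; exact: ltnW.
Qed.

Definition digit_eq n (d : 'I_(l n).+2) : set digit_space := [set w | w n = d].

Lemma measurable_digit_eq n (d : 'I_(l n).+2) : measurable (digit_eq d).
Proof.
by apply: (@finitely_determined_measurable n.+1) => w w' ww' <-; exact: ww'.
Qed.

(** * Measures on digit sequences, determined by cylinders *)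

Section Measure.
Variable R : realType.
Implicit Types mu nu : {measure set digit_space -> \bar R}.

Lemma digit_equidistributed mu (A : set digit_space) n (x : \bar R)
    (d : 'I_(l n).+2) : measurable A ->
    (forall d : 'I_(l n).+2, mu (A `&` digit_eq d) = x) ->
  mu A = (((l n).+2)%:R%:E * x)%E.
Proof.
move=> mA Ax.
have {1}-> : A = \big[setU/set0]_(d in 'I_(l n).+2) (A `&` digit_eq d).
  rewrite -bigcup_pred -setI_bigcupr setIidl// => w _.
  by exists (w n); rewrite //= inE.
rewrite measure_bigsetU_ord.
- rewrite mule_natl (eq_bigr (fun=> x)) => [|i _]; last exact: Ax. 
  by rewrite big_const card_ord -Monoid.iteropE.
- by move=> i; apply: measurableI => //; exact: measurable_digit_eq.
apply/trivIsetP => i j _ _ ij; rewrite -subset0 => w [[_ wi] [_ wj]].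
by move/eqP: ij; apply; rewrite -wi -wj.
Qed.

(** Cylinders form a generating pi-system containing the whole space, so uniqueness of measures
    applies. *)
Lemma measure_eq_cylinders mu nu : (mu setT < +oo)%E ->
    (forall n c, mu (cylinder n c) = nu (cylinder n c)) ->
  forall A, measurable A -> mu A = nu A.
Proof.
move=> fin mn A mA.
have := @measure_unique _ R digit_space cylinders (fun=> setT) erefl _ _ _
  mu nu _ _ A.
apply=> //.
- exact: setI_cylinders.
- by move=> _; right; exists 0%N, (fun=> 0); rewrite cylinder0.
- by rewrite bigcup_const//; exists 0%N.
- by move=> B [->|[n [c ->]]]; rewrite ?measure0.
Qed.

End Measure.

(** * The uniform law on digits, from mixed-radix expansions *)

Definition radix n := (\prod_(k < n) (l k).+2)%N.

Lemma radixS n : radix n.+1 = (radix n * (l n).+2)%N.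
Proof. exact: big_ord_recr. Qed.

Lemma radix_gt0 n : (0 < radix n)%N.
Proof. by rewrite prodn_gt0. Qed.

Lemma truncn_divn (R : realType) (x : R) L : 0 <= x -> (0 < L)%N ->
  Num.truncn x = (Num.truncn (x * L%:R) %/ L)%N.
Proof.
move=> x0 L0; apply: truncn_def.
have L0' : 0 < L%:R :> R by rewrite ltr0n.
have /andP[y1 y2] := truncn_itv (mulr_ge0 x0 (ltW L0')).
set m := Num.truncn _ in y1 y2 *.
rewrite -(ler_pM2r L0') -(ltr_pM2r L0') -!natrM; apply/andP; split.
  by rewrite (le_trans _ y1)// ler_nat leq_divM.
by rewrite (lt_le_trans y2)// ler_nat ltn_ceil.
Qed.

Section Expansion.
Variable R : realType.

(* Mixed-radix digits: they turn the uniform law on [0, 1[ into the product of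
   the uniform laws on digits. *)
Definition expansion (x : measurableTypeR R) : digit_space :=
  fun k => (Num.truncn ((x : R) * (radix k.+1)%:R))%:R.

(** [a] is the integer whose mixed-radix digits are the first [n] entries of [c], the last being
    least significant; the cylinder becomes an interval of length 1 / radix n. *)
Lemma cylinder_expansion n (c : digits) : exists2 a, (a < radix n)%N &
  forall x : R, 0 <= x < 1 ->
    cylinder n c (expansion x) <-> Num.truncn (x * (radix n)%:R) = a.
Proof.
elim: n => [|n [a an IH]].
  exists 0%N; first by rewrite /radix big_ord0.
  move=> x /andP[x0 x1]; rewrite cylinder0 /radix big_ord0 mulr1; split => // _.
  by apply/eqP; rewrite truncn_eq// x0.
exists (a * (l n).+2 + c n)%N.
  rewrite radixS (leq_trans _ (leq_mul an (leqnn _)))// mulSn addnC.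
  by rewrite ltn_add2r.
move=> x x01; have /andP[x0 _] := x01.
have E : Num.truncn (x * (radix n)%:R) =
    (Num.truncn (x * (radix n.+1)%:R) %/ (l n).+2)%N.
  by rewrite radixS natrM mulrA -truncn_divn// mulr_ge0.
have dE m : (m%:R == c n :> 'I_(l n).+2) = (m %% (l n).+2 == c n)%N.
  by rewrite Zp_nat -val_eqE.
split=> [xc|xa].
  have xa : Num.truncn (x * (radix n)%:R) = a.
    by apply/IH => // k kn; apply: xc; exact: ltnW.
  have := xc n (ltnSn n) => /eqP; rewrite /expansion dE => /eqP <-.
  by rewrite -xa E -divn_eq.
move=> k; rewrite ltnS leq_eqVlt => /predU1P[->|kn].
  apply/eqP; rewrite dE xa modnMDl modn_small//.
by move: k kn; apply/IH => //; rewrite E xa divnMDl// divn_small ?addn0.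
Qed.

Lemma measurable_truncn_eq (M : R) m :
  measurable [set x | Num.truncn (x * M) = m].
Proof.
have mlt q : measurable [set x | x * M < q].
  have mM : measurable_fun setT (fun x : R => x * M) by exact: mulrr_measurable.
  have := mM measurableT _ (measurable_itv `]-oo, q[).
  rewrite setTI; congr (measurable _); apply/seteqP; split=> x /=;
  by rewrite in_itv.
have mle q : measurable [set x | (Num.truncn (x * M) <= q)%N].
  rewrite (_ : mkset _ = [set x | x * M < q.+1%:R])//.
  by apply/seteqP; split=> x /=; rewrite truncn_le_nat.
case: m => [|m].
  rewrite (_ : mkset _ = [set x | (Num.truncn (x * M) <= 0)%N])//.
  by apply/seteqP; split=> x /=; rewrite leqn0 => /eqP.
rewrite (_ : mkset _ = [set x | (Num.truncn (x * M) <= m.+1)%N] `\`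
  [set x | (Num.truncn (x * M) <= m)%N]); first exact: measurableD.
apply/seteqP; split=> x /=; first by move=> ->; rewrite ltnn.
by move=> [h /negP]; rewrite -ltnNge => h'; apply/eqP; rewrite eqn_leq h.
Qed.

Lemma measurable_expansion : measurable_fun setT expansion.
Proof.
apply: (@measurability _ _ (measurableTypeR R) digit_space setT expansion
  cylinders erefl) => _ [_ [->|[n [c ->]]] <-].
  by rewrite preimage_set0 setI0.
rewrite setTI (_ : _ @^-1` _ =
    \bigcap_(k in `I_n) [set x | expansion x k = c k]).
  apply: fin_bigcap_measurable => // k _.
  rewrite (_ : mkset _ = \bigcup_(m in [set m | m%:R = c k])
     [set x | Num.truncn (x * (radix k.+1)%:R) = m]); last first.
    apply/seteqP; split=> [x xc|x [m/= <- <-]//].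
    by exists (Num.truncn (x * (radix k.+1)%:R)).
  apply: bigcup_measurable => m _.
  exact: measurable_truncn_eq.
by [].
Qed.

HB.instance Definition _ := isMeasurableFun.Build _ _
  (measurableTypeR R) digit_space expansion
  measurable_expansion.

(** Points outside [0, 1[ stay in the space but carry no mass, so only the expansions of numbers of
    that interval count. *)
Definition uniform01 : set (measurableTypeR R) -> \bar R :=
  mrestr (@lebesgue_measure R)
    (measurable_itv `[0%R, 1%R[).

HB.instance Definition _ := Measure.on uniform01.

Lemma uniform01_setT : uniform01 setT = 1%E.
Proof.
rewrite /uniform01 /mrestr setTI/= lebesgue_measure_itv/=.
by rewrite lte_fin ltr01 sube0.
Qed.

HB.instance Definition _ :=
  Measure_isProbability.Build _ (measurableTypeR R) R uniform01 uniform01_setT.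

Definition law : probability digit_space R := distribution uniform01 expansion.

Lemma law_cylinder n c : law (cylinder n c) = ((radix n)%:R^-1)%:E.
Proof.
have [a an ca] := cylinder_expansion n c.
have r0 : 0 < (radix n)%:R :> R by rewrite ltr0n radix_gt0.
rewrite /law /= /distribution /pushforward /uniform01 /mrestr.
rewrite (_ : _ `&` _ = `[a%:R / (radix n)%:R, a.+1%:R / (radix n)%:R[%classic).
  rewrite lebesgue_measure_itv/= lte_fin ltr_pM2r ?invr_gt0// ltr_nat ltnSn.
  by rewrite -EFinD -mulrBl -natrB// subSnn mul1r.
apply/seteqP; split=> x /=; rewrite !in_itv/= ler_pdivrMr// ltr_pdivlMr//.
  move=> [xc /[dup] /andP[x0 _] /ca xa]; move/xa: xc => /eqP.
  by rewrite truncn_eq// mulr_ge0// ltW.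
move=> /andP[ax xa].
have x01 : 0 <= x < 1.
  rewrite -(pmulr_lge0 _ r0) (le_trans _ ax)//=.
  by rewrite -(ltr_pM2r r0) mul1r (lt_le_trans xa)// ler_nat.
by split=> //; apply/(ca x x01)/truncn_def; rewrite ax.
Qed.

(** * Translations of the digits: invariance and a zero-one law *)

Definition translate (a w : digit_space) : digit_space := fun k => w k + a k.

Lemma translate_cylinder a n c :
  translate a @^-1` cylinder n c = cylinder n (fun k => c k - a k).
Proof.
apply/seteqP; split=> w wc k /wc /=; first by move=> <-; rewrite addrK.
by rewrite /translate => ->; rewrite subrK.
Qed.

Lemma measurable_translate a : measurable_fun setT (translate a).
Proof.
apply: (@measurability _ _ digit_space digit_space setT (translate a) cylinders
  erefl) => _ [_ [->|[n [c ->]]] <-]; first by rewrite preimage_set0 setI0.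
by rewrite setTI translate_cylinder; exact: measurable_cylinder.
Qed.

HB.instance Definition _ a :=
  isMeasurableFun.Build _ _ digit_space digit_space (translate a)
  (measurable_translate a).

(** Translations permute the cylinders of each length, which all have the same mass, and cylinders
    determine the measure. *)
Lemma law_translate a A : measurable A -> law (translate a @^-1` A) = law A.
Proof.
move=> mA.
apply: (@measure_eq_cylinders R (distribution law (translate a)) law) => //.
  exact: le_lt_trans (probability_le1 _ measurableT) (ltry _).
move=> n c; transitivity (law (translate a @^-1` cylinder n c))  => //.
by rewrite translate_cylinder law_cylinder; exact/esym/law_cylinder.
Qed.

(** Translating digit [n] alone exchanges these events, so they are equiprobable and share mass
    1. *)
Lemma law_digit_eq n (d : 'I_(l n).+2) :
  law (digit_eq d) = ((l n).+2%:R^-1)%:E.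
Proof.
have dd (d' : 'I_(l n).+2) : law (setT `&` digit_eq d') = law (digit_eq d).
  rewrite setTI -[RHS](law_translate (dfwith (fun=> 0) n (d - d'))); last first.
    exact: measurable_digit_eq.
  congr (law _).
  apply/seteqP; split=> w; rewrite /digit_eq /translate/= dfwithin.
    by move=> ->; rewrite addrC subrK.
  by move/(canRL (addrK _)) ->; rewrite opprB addrC subrK.
have := etrans (esym (probability_setT law))
  (digit_equidistributed d measurableT dd).
rewrite -[law _]fineK ?fin_num_measure//; last first.
  exact: measurable_digit_eq.
rewrite -EFinM => -[E]; congr (_%:E).
have n0 : (l n).+2%:R != 0 :> R by rewrite pnatr_eq0.
by apply: (mulfI n0); rewrite -E divff.
Qed.

(* The translations make the cylinders of a given length equiprobable inside
   [F]; hence [F] is independent of every event, itself included. *)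
Lemma law_zero_one F : measurable F ->
    (forall n (d : 'I_(l n).+2), exists a : digits,
      [/\ forall k, (k < n)%N -> a k = 0, a n = d & translate a @^-1` F = F]) ->
  law F = 0%E \/ law F = 1%E.
Proof.
move=> mF Fa.
have indep n c : ((radix n)%:R%:E * law (F `&` cylinder n c) = law F)%E.
  elim: n => [|n IH]; first by rewrite /radix big_ord0 mul1e cylinder0 setIT.
  rewrite -IH radixS natrM EFinM -muleA; congr (_ * _)%E; apply/esym.
  apply: (digit_equidistributed (c n)).
    by apply: measurableI => //; exact: measurable_cylinder.
  (* Preimage under this translation turns the prescribed digit [c n] into [d] and keeps the earlier
     ones, so every value of digit [n] gets the same share of [F]. *)
  move=> d; have [a [a0 ad aF]] := Fa n (c n - d).
  rewrite -[in RHS](law_translate a); last first.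
    by apply: measurableI => //; exact: measurable_cylinder.
  rewrite preimage_setI aF translate_cylinder -setIA; congr (law (_ `&` _)).
  apply/seteqP; split=> w /=.
    move=> [wc wd] k; rewrite ltnS leq_eqVlt => /predU1P[->|kn].
      by rewrite ad wd opprB addrC subrK.
    by rewrite wc// a0// subr0.
  move=> wc; split=> [k kn|]; first by rewrite wc ?a0 ?subr0// ltnW.
  by rewrite /digit_eq /= wc// ad opprB addrC subrK.
have f0 : 0 <= fine (law F) by rewrite fine_ge0.
have lF : law F = (fine (law F))%:E by rewrite fineK ?fin_num_measure.
have : law F = ((fine (law F))%:E * law F)%E.
  rewrite -[LHS](congr1 law (setIid F)).
  apply: (@measure_eq_cylinders R (mrestr law mF)
    (mscale (NngNum f0) law)) => //.
    apply: le_lt_trans (ltry 1); apply: (probability_le1 law).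
    exact: measurableI.
  move=> n c; transitivity (law (F `&` cylinder n c)).
    by rewrite setIC.
  have r0 : (radix n)%:R != 0 :> R by rewrite pnatr_eq0 gtn_eqF// radix_gt0.
  transitivity ((fine (law F))%:E * ((radix n)%:R^-1)%:E)%E; last first.
    by congr (_ * _)%E; exact/esym/law_cylinder.
  have mC : measurable (F `&` cylinder n c).
    by apply: measurableI => //; exact: measurable_cylinder.
  have := indep n c; rewrite lF -[law (F `&` _)]fineK ?fin_num_measure//.
  by rewrite -!EFinM => -[<-]; rewrite mulrAC divff// mul1r.
rewrite {1 3}lF -EFinM lF => -[/eqP].
rewrite -[X in X == _]mul1r -subr_eq0 -mulrBl mulf_eq0 subr_eq0.
by move=> /orP[/eqP <-|/eqP ->]; [right|left].
Qed.

End Expansion.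

End Digits.

(** * The spacings and the action of the lattice on the walls *)

Lemma image_translate l (a : digits l) (A : set (digit_space l)) :
  translate a @` A = translate (fun k => - a k) @^-1` A.
Proof.
apply/seteqP; split=> [_ [w Aw <-]|w Aw] /=.
  rewrite (_ : translate _ _ = w)//.
  by apply: functional_extensionality_dep => k; rewrite /translate addrK.
by exists (translate (fun k => - a k) w) => //;
  apply: functional_extensionality_dep => k; rewrite /translate subrK.
Qed.

(* The spacing of level k is [L_k = (gap k).+2], that is
   [4 ^ k.+1 * L_0 * ... * L_(k-1) + 1], and [modprod n] is
   [L_0 * ... * L_(n-1)]. *)
Fixpoint modprod n := if n is n'.+1 then
  (modprod n' * (4 ^ n'.+1 * modprod n').+1)%N else 1%N.

Definition gap k := (4 ^ k.+1 * modprod k).-1.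

Lemma modprod_gt0 n : (0 < modprod n)%N.
Proof. by elim: n => //= n IH; rewrite muln_gt0 IH. Qed.

(** The shape of the spacing serves twice: L_k is 1 modulo every earlier spacing, hence coprime to
    it, and the power of 4 will make the obstruction probabilities summable. *)
Lemma gapE k : (gap k).+2 = (4 ^ k.+1 * modprod k).+1.
Proof. by rewrite /gap prednK// muln_gt0 expn_gt0 modprod_gt0. Qed.

Lemma gap_dvd k n : (k < n)%N -> ((gap k).+2 %| modprod n)%N.
Proof.
elim: n => // n IH; rewrite ltnS leq_eqVlt => /predU1P[->|/IH kn].
  by rewrite gapE dvdn_mull.
by rewrite /= dvdn_mulr.
Qed.

Lemma Zp_natr_eq0 p n : (p.+2 %| n)%N -> n%:R = 0 :> 'I_p.+2.
Proof. by move=> pn; apply/val_inj; rewrite Zp_nat /=; apply/eqP. Qed.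

Definition axis k : 'I_3 := if odd k then 1 else 0.

Definition offset (z : 'rV[int]_3) : digits gap :=
  fun k => (z ord0 (axis k))%:~R.

(** The Chinese remainder step, giving the translations that [law_zero_one] asks for. *)
Lemma offset_interpolation n (d : 'I_(gap n).+2) :
  exists z, (forall k, (k < n)%N -> offset z k = 0) /\ offset z n = d.
Proof.
pose e := (4 ^ n.+1 * modprod n)%N.
(* [e] is -1 modulo [L_n] and 0 modulo [L_k] for k < n. *)
exists (\row_i if i == axis n then - (e * d)%N%:Z else 0); split=> [k kn|].
  rewrite /offset mxE; case: ifP => // _.
  rewrite rmorphN /= -[X in - X]/((e * d)%N%:R) Zp_natr_eq0 ?oppr0//.
  by rewrite dvdn_mulr// dvdn_mull// gap_dvd.
rewrite /offset mxE eqxx rmorphN /= -[X in - X]/((e * d)%N%:R) natrM natr_Zp.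
rewrite (_ : e%:R = -1) ?mulN1r ?opprK//.
by apply/eqP; rewrite -subr_eq0 opprK natr1 -gapE Zp_natr_eq0.
Qed.

Definition shift_action z := translate (offset z).

Lemma offsetN z : offset (- z) = fun k => - offset z k.
Proof.
by apply: functional_extensionality_dep => k; rewrite /offset mxE rmorphN.
Qed.

Lemma shift_actionD z z' :
  shift_action (z + z') = shift_action z \o shift_action z'.
Proof.
apply/funext => w; apply: functional_extensionality_dep => k.
rewrite /= /shift_action /translate /offset mxE rmorphD.
by rewrite [X in _ + X]addrC addrA.
Qed.

Lemma shift_action_image z A :
  shift_action z @` A = shift_action (- z) @^-1` A.
Proof. by rewrite image_translate -offsetN. Qed.

(** Digit [k] locates the origin relative to the level [k] walls and is 0 when the origin is on one.
    The event says that the highest level through the origin exists and is even. *)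
Definition even_top : set (digit_space gap) :=
  \bigcup_(k in [set k | ~~ odd k]) (@digit_eq gap k 0 `&`
    \bigcap_(j in [set j | (k < j)%N]) ~` @digit_eq gap j 0).

Lemma measurable_even_top : measurable even_top.
Proof.
apply: bigcup_measurable => k _; apply: measurableI.
  exact: measurable_digit_eq.
apply: bigcap_measurable; first by exists k.+1 => /=.
by move=> j _; apply: measurableC; exact: measurable_digit_eq.
Qed.

(** * The game and its structural properties *)

Section Game.
Variable R : realType.

(** Reading the environment after translation by [z] brings the state to the origin and makes
    stationarity automatic. *)
Definition game_payoff (w : digit_space gap) (z : 'rV[int]_3)
    (i j : bool) : R :=
  \1_even_top (shift_action z w).

Definition game_trans (i j : bool) : 'rV[int]_3 :=
  \row_k nth 0 [:: (i : nat)%:Z; (j : nat)%:Z; 1] k.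

Lemma shift_action_measurable z : measurable_fun setT (shift_action z).
Proof. exact: measurable_translate. Qed.

Lemma shift_action_measurable_image z (A : set (digit_space gap)) :
  measurable A -> measurable (shift_action z @` A).
Proof.
by move=> mA; rewrite shift_action_image -[X in measurable X]setTI;
  exact: shift_action_measurable.
Qed.

Lemma shift_action_preserving z (A : set (digit_space gap)) :
  measurable A -> law gap R (shift_action z @` A) = law gap R A.
Proof. by move=> mA; rewrite shift_action_image; exact: law_translate. Qed.

Lemma shift_action_ergodic (A : set (digit_space gap)) : measurable A ->
    (forall z, shift_action z @` A = A) ->
  law gap R A = 0%E \/ law gap R A = 1%E.
Proof.
move=> mA Ainv; apply: law_zero_one => // n d.
have [z [z0 zd]] := offset_interpolation d.
exists (offset z); split=> //.
by rewrite -[RHS](Ainv (- z)) shift_action_image opprK.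
Qed.

Lemma game_payoff_measurable z i j :
  measurable_fun setT (fun w => game_payoff w z i j).
Proof.
apply: measurableT_comp (shift_action_measurable z).
by apply: measurable_indic; exact: measurable_even_top.
Qed.

Lemma game_payoff_bounded :
  exists M : R, forall w z i j, `|game_payoff w z i j| <= M.
Proof.
exists 1 => w z i j; rewrite /game_payoff indicE.
by case: (_ \in _); rewrite ?normr1 ?normr0.
Qed.

Lemma game_payoff_stationary z z' i j w :
  game_payoff (shift_action z w) z' i j = game_payoff w (z + z') i j.
Proof. by rewrite /game_payoff addrC shift_actionD. Qed.

Lemma card_bool_gt0 : (0 < #|{: bool}|)%N.
Proof. by rewrite card_bool. Qed.

Definition chase_game : percolation_game R 3 :=
  @PercolationGame R 3 bool bool card_bool_gt0 card_bool_gt0 _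
   (digit_space gap) (law gap R) shift_action
   shift_action_measurable shift_action_measurable_image
   shift_action_preserving shift_actionD shift_action_ergodic
   game_payoff game_payoff_measurable game_payoff_bounded
   game_payoff_stationary game_trans.

Lemma chase_game_oriented : oriented chase_game.
Proof.
(* The third unit vector: every transition has last coordinate 1. *)
exists (\row_k (k == ord_max)%:Z) => i j.
by rewrite big_ord_recr big_ord_recr big_ord1/= !mxE/= !mulr0 !add0r.
Qed.

Lemma chase_game_payoffs01 : payoffs01 chase_game.
Proof.
by move=> w z i j; rewrite /= /game_payoff indicE; case: (_ \in _);
  [right|left].
Qed.

End Game.

Lemma state_atS (R : realType) d (G : percolation_game R d) z
    (s : strategy1 G) (r : strategy2 G) m :
  state_at z s r m.+1 =
    state_at z s r m + trans (act1_at z s r m) (act2_at z s r m).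
Proof.
by rewrite /act2_at /act1_at /state_at /=; case: (play z s r m).
Qed.

(** * Bounds on the value from a single strategy *)

Section Values.
Variables (R : realType) (d : nat) (G : percolation_game R d).
Hypothesis G01 : payoffs01 G.
Implicit Types (s : strategy1 G) (r : strategy2 G).

Lemma mean_payoff01 z s r n w : 0 <= mean_payoff z s r n w <= 1.
Proof.
have p01 m : 0 <= payoff w (state_at z s r m) (act1_at z s r m)
    (act2_at z s r m) <= 1.
  by have [->|->] := G01 w (state_at z s r m) (act1_at z s r m)
    (act2_at z s r m); rewrite lexx ler01.
rewrite /mean_payoff mulr_ge0 ?invr_ge0//=; last first.
  by apply: sumr_ge0 => m _; have /andP[] := p01 m.
(* For n = 0 the inverse of 0 is 0 by convention, so the mean payoff is 0. *)
case: n => [|n]; first by rewrite invr0 mul0r.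
rewrite mulrC ler_pdivrMr// mul1r -[X in _ <= X%:R]card_ord -sumr_const.
by apply: ler_sum => m _; have /andP[] := p01 m.
Qed.

Lemma actions_inhabited :
  (exists i : act1 G, True) /\ (exists j : act2 G, True).
Proof.
by split; [have /card_gt0P[i _] := act1_gt0 G; exists i
          |have /card_gt0P[i _] := act2_gt0 G; exists i].
Qed.

Lemma inf_mean_payoff_le z s r n w :
  inf (range (fun r => mean_payoff z s r n w)) <= mean_payoff z s r n w.
Proof.
apply: ge_inf; last by exists r.
by exists 0 => _ [r' _ <-]; have /andP[] := mean_payoff01 z s r' n w.
Qed.

(** [sup] and [inf] obey their order laws on nonempty bounded sets: constant strategies give
    nonemptiness, payoffs in {0, 1} give bounds. *)
Lemma value_ge z n w s x : (forall r, x <= mean_payoff z s r n w) ->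
  x <= value n z w.
Proof.
have [_ [j _]] := actions_inhabited.
pose r0 : strategy2 G := fun _ _ _ _ => j.
move=> xs.
apply: (@le_trans _ _ (inf (range (fun r => mean_payoff z s r n w)))).
  apply: lb_le_inf; first by exists (mean_payoff z s r0 n w), r0.
  by move=> _ [r _ <-].
apply: ub_le_sup; last by exists s.
exists 1 => _ [s' _ <-]; apply: le_trans (inf_mean_payoff_le _ _ r0 _ _) _.
by have /andP[] := mean_payoff01 z s' r0 n w.
Qed.

(** Although [value] is a max-min, one [r] chosen before [s] suffices: it bounds every inner infimum
    from above. *)
Lemma value_le z n (w : Omega G) r x : (forall s, mean_payoff z s r n w <= x) ->
  value n z w <= x.
Proof.
have [[i _] _] := actions_inhabited.
pose s0 : strategy1 G := fun _ _ _ => i.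
move=> xr; apply: ge_sup.
  by exists (inf (range (fun r => mean_payoff z s0 r n w))), s0.
by move=> _ [s _ <-]; apply: le_trans (inf_mean_payoff_le _ _ r _ _) _.
Qed.

Lemma value01 z n (w : Omega G) : 0 <= value n z w <= 1.
Proof.
have [[i _] [j _]] := actions_inhabited.
apply/andP; split.
  apply: (value_ge (s := fun _ _ _ => i)) => r.
  by have /andP[] := mean_payoff01 z (fun _ _ _ => i) r n w.
apply: (value_le (r := fun _ _ _ _ => j)) => s.
by have /andP[] := mean_payoff01 z s (fun _ _ _ _ => j) n w.
Qed.

End Values.

(** * Upper and lower limits, averages, and the chase of a residue *)

Lemma limn_sup_eq (R : realType) (u : nat -> R) c : (forall n, u n <= c) ->
    (forall e n, 0 < e -> exists2 m, (n <= m)%N & c - e <= u m) ->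
  limn_sup u = c.
Proof.
move=> uc cu; rewrite /limn_sup (_ : sups u = cst c) ?lim_cst//.
apply/funext => n; apply/eqP; rewrite eq_le; apply/andP; split.
  by apply: ge_sup => [|_ [m _ <-]//]; exists (u n), n => /=.
apply/ler_addgt0Pr => e e0; have [m nm cm] := cu e n e0.
rewrite -lerBlDr (le_trans cm)//; apply: ub_le_sup; last by exists m.
by exists c => _ [p _ <-].
Qed.

Lemma limn_inf_eq (R : realType) (u : nat -> R) c : (forall n, c <= u n) ->
    (forall e n, 0 < e -> exists2 m, (n <= m)%N & u m <= c + e) ->
  limn_inf u = c.
Proof.
move=> uc cu; rewrite /limn_inf (_ : infs u = cst c) ?lim_cst//.
apply/funext => n; apply/eqP; rewrite eq_le; apply/andP; split; last first.
  by apply: lb_le_inf => [|_ [m _ <-]//]; exists (u n), n => /=.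
apply/ler_addgt0Pr => e e0; have [m nm cm] := cu e n e0.
rewrite (le_trans _ cm)//; apply: ge_inf; last by exists m.
by exists c => _ [p _ <-].
Qed.

(** Only the first [L] of the [N * L] terms can differ from [c], each by at most 1. *)
Lemma mean_close (R : realType) (p : nat -> R) c L N : (0 < L)%N -> (0 < N)%N ->
    (forall m, `|p m - c| <= 1) ->
    (forall m, (L <= m < N * L)%N -> p m = c) ->
  `|(N * L)%:R^-1 * (\sum_(m < N * L) p m) - c| <= N%:R^-1.
Proof.
move=> L0 N0 p1 pc.
have NL0 : 0 < (N * L)%:R :> R by rewrite ltr0n muln_gt0 N0.
have -> : (N * L)%:R^-1 * (\sum_(m < N * L) p m) - c =
    (N * L)%:R^-1 * (\sum_(m < N * L) (p m - c)).
  rewrite sumrB sumr_const card_ord mulrBr -[c *+ _]mulr_natl mulrA.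
  by rewrite mulVf ?mul1r// gt_eqF.
rewrite normrM gtr0_norm ?invr_gt0// mulrC ler_pdivrMr// natrM.
rewrite mulKf; last first.
  by rewrite pnatr_eq0 -lt0n.
apply: (le_trans (ler_norm_sum _ _ _)).
rewrite -(big_mkord predT (fun m => `|p m - c|)).
rewrite (@big_cat_nat _ _ _ L)//=; last first.
  by rewrite leq_pmull.
rewrite [X in _ + X]big1_seq ?addr0 => [|m /=]; last first.
  by rewrite mem_index_iota => /pc ->; rewrite subrr normr0.
by rewrite -[L in leRHS]subn0 -sumr_const_nat; apply: ler_sum => m _.
Qed.

(** [a + x] runs through consecutive residues modulo p.+2 until it meets 0, where [x] stops for
    good; this takes at most p.+1 steps. *)
Lemma chase p (a : 'I_p.+2) (x : nat -> int) :
    (forall m, x m.+1 = x m + (a + (x m)%:~R != 0 : nat)%:Z) ->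
  forall m, (p.+2 <= m)%N -> a + (x m)%:~R = 0.
Proof.
move=> xS; pose hit m := a + (x m)%:~R == 0.
have hitS m : hit m -> hit m.+1.
  by move=> hm; rewrite /hit xS -/(hit m) hm addr0.
have hitD m j : hit m -> hit (m + j)%N.
  by move=> hm; elim: j => [|j IH]; rewrite ?addn0// addnS hitS.
have free m : hit m \/ x m = x 0%N + m%:Z.
  elim: m => [|m [hm|xm]]; first by right; rewrite addr0.
    by left; exact: hitS.
  have [hm|nhm] := boolP (hit m); first by left; exact: hitS.
  by right; rewrite xS nhm xm -addrA -PoszD addn1.
(* The number of unit steps from the start to residue 0, a residue read as a natural number. *)
pose D : 'I_p.+2 := - (a + (x 0%N)%:~R).
have hD : hit D.
  have [//|xD] := free D.
  rewrite /hit xD rmorphD /= -[X in _ + (_ + X)]/(D%:R) natr_Zp addrA.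
  by rewrite /D subrr.
move=> m pm; apply/eqP; rewrite -/(hit m).
rewrite -(subnKC (ltnW (leq_trans (ltn_ord D) pm))).
exact: hitD.
Qed.

(** * Reaching and following a wall in the game *)

Section ChaseGame.
Variable R : realType.
Local Notation G := (chase_game R).
Implicit Types (s : strategy1 G) (r : strategy2 G) (w : digit_space gap).

Definition mover s r z m k : bool :=
  if odd k then act2_at z s r m else act1_at z s r m.

Lemma state_axis s r z m k :
  state_at z s r m.+1 ord0 (axis k) =
  state_at z s r m ord0 (axis k) + (mover s r z m k : nat)%:Z.
Proof.
by rewrite state_atS mxE /mover /axis /= /game_trans mxE; case: odd.
Qed.

Lemma state_drift s r z m k : exists2 e, (e <= m)%N &
  state_at z s r m ord0 (axis k) = z ord0 (axis k) + e%:Z.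
Proof.
elim: m => [|m [e em IH]]; first by exists 0%N; rewrite ?addr0.
exists (e + mover s r z m k)%N.
  by case: mover; rewrite ?addn1 ?addn0// ltnW.
by rewrite state_axis IH -addrA.
Qed.

Definition horizon k := (2 ^ k * (gap k).+2)%N.

(** The condition ranges over displacements rather than plays: whatever the players do, a coordinate
    grows by at most 1 per stage. *)
Definition unobstructed w z k := forall j m,
  (k < j)%N -> (m <= horizon k)%N -> shift_action z w j + m%:R <> 0.

Lemma top_level w k : w k = 0 -> (forall j, (k < j)%N -> w j <> 0) ->
  \1_even_top w = (~~ odd k)%:R :> R.
Proof.
move=> wk wj; rewrite indicE; congr (_%:R); congr nat_of_bool.
apply/idP/idP; last first.
  by move=> ko; rewrite inE; exists k => //; split => // j /= /wj.
rewrite inE => -[i /= io [wi wij]].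
have [ik|ki|<-//] := ltngtP i k.
  by have := wij k ik.
by have := wj i ki.
Qed.

(** [chase] puts the state on a level [k] wall from stage (gap k).+2 on, while [state_drift] and
    [unobstructed] exclude higher levels up to the horizon; so [k] is the top level. *)
Lemma chase_payoff w z s r k m : unobstructed w z k ->
    (forall m, mover s r z m k = (shift_action (state_at z s r m) w k != 0)) ->
    ((gap k).+2 <= m < horizon k)%N ->
  game_payoff R w (state_at z s r m) (act1_at z s r m) (act2_at z s r m) =
  (~~ odd k)%:R.
Proof.
move=> wzk mv /andP[km mk]; apply: top_level => [|j kj].
  apply: (@chase (gap k) (w k) (fun m => state_at z s r m ord0 (axis k))) => //.
  by move=> q; rewrite state_axis mv.
have [e em E] := state_drift s r z m j.
have := wzk j e kj (leq_trans em (ltnW mk)).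
rewrite /shift_action /translate /offset. by rewrite E rmorphD addrA.
Qed.

Lemma chase_mean_payoff w z s r k : unobstructed w z k ->
    (forall m, mover s r z m k = (shift_action (state_at z s r m) w k != 0)) ->
  `|mean_payoff z s r (horizon k) w - (~~ odd k)%:R| <= (2 ^ k)%:R^-1.
Proof.
move=> wzk mv; 
have := @mean_close R (fun m => game_payoff R w (state_at z s r m)
  (act1_at z s r m) (act2_at z s r m)) (~~ odd k)%:R (gap k).+2 (2 ^ k)%N.
apply=> //.
- by rewrite expn_gt0.
- move=> m; rewrite /game_payoff indicE; case: (_ \in _); case: odd;
  by rewrite /= ?subrr ?sub0r ?subr0 ?normrN ?normr0 ?normr1.
- by move=> m; exact: chase_payoff.
Qed.

(** The controlling player moves exactly when off the level [k] walls; the opponent cannot alter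
    that coordinate, so the estimate holds against every strategy. *)
Lemma chase_value w z k : unobstructed w z k ->
  if odd k then value (G := G) (horizon k) z w <= (2 ^ k)%:R^-1
  else 1 - (2 ^ k)%:R^-1 <= value (G := G) (horizon k) z w.
Proof.
move=> wzk; case: ifPn => ko.
  pose r : strategy2 G := fun m h zm i => shift_action zm w k != 0.
  apply: (value_le (@chase_game_payoffs01 R) (r := r)) => s.
  have := @chase_mean_payoff w z s r k wzk.
  rewrite /mover ko subr0 => /(_ (fun=> erefl)).
  by apply: le_trans; exact: ler_norm.
pose s : strategy1 G := fun m h zm => shift_action zm w k != 0.
apply: (value_ge (@chase_game_payoffs01 R) (s := s)) => r.
have := @chase_mean_payoff w z s r k wzk.
rewrite /mover (negbTE ko) => /(_ (fun=> erefl)).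
by rewrite ler_distl => /andP[].
Qed.

Lemma horizon_ge k : (k <= horizon k)%N.
Proof.
rewrite (leq_trans (ltnW (ltn_expl k (ltnSn 1))))// /horizon.
by rewrite leq_pmulr.
Qed.

Lemma chase_oscillates w z K : (forall k, (K <= k)%N -> unobstructed w z k) ->
  limn_sup (fun n : nat => value (G := G) n z w) = 1 /\
  limn_inf (fun n : nat => value (G := G) n z w) = 0.
Proof.
move=> wz.
have small (e : R) n b : 0 < e -> exists k,
    [/\ (K <= k)%N, (n <= horizon k)%N, odd k = b & (2 ^ k)%:R^-1 <= e].
  (* [q] meets every threshold, and k = b + 2q still does while having parity [b]; as k > 1 / e,
     also 2 ^ -k <= e. *)
  move=> e0; pose t := Num.truncn e^-1; pose q := (K + (n + t.+1))%N.
  have [Kq nq tq] : [/\ K <= q, n <= q & t < q]%N.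
    by rewrite /q leq_addr addnCA leq_addr addnA leq_addl.
  have qk : (q <= b + q.*2)%N by rewrite -addnn addnA leq_addl.
  exists (b + q.*2)%N; split.
  - exact: leq_trans qk.
  - exact: leq_trans nq (leq_trans qk (horizon_ge _)).
  - by rewrite oddD odd_double addbF oddb.
  rewrite invf_ple ?posrE// ?ltr0n ?expn_gt0//.
  rewrite (le_trans (ltW (truncnS_gt _)))// ler_nat (leq_trans tq)//.
  exact: leq_trans qk (ltnW (ltn_expl _ (ltnSn 1))).
have v01 n := value01 (@chase_game_payoffs01 R) z n w.
split.
  apply: limn_sup_eq => [n|e n /(small e n false)[k [Kk nk ko ke]]].
    by have /andP[] := v01 n.
  exists (horizon k) => //; have := chase_value (wz k Kk); rewrite ko.
  by apply: le_trans; rewrite lerB.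
apply: limn_inf_eq => [n|e n /(small e n true)[k [Kk nk ko ke]]].
  by have /andP[] := v01 n.
exists (horizon k) => //; have := chase_value (wz k Kk); rewrite ko add0r.
by move/le_trans; exact.
Qed.

(** * Borel-Cantelli for obstructions by higher walls *)

Definition obstruction z k : set (digit_space gap) :=
  [set w | exists2 m, (m <= horizon k)%N & shift_action z w k.+1 + m%:R = 0].

Lemma obstructionE z k : obstruction z k =
  \bigcup_(m in `I_(horizon k).+1) (digit_eq (- m%:R - offset z k.+1)).
Proof.
apply/seteqP; split=> w [m mk wm]; exists m => //.
  move/eqP: wm; rewrite addr_eq0 => /eqP wm.
  by rewrite /digit_eq /= -wm /shift_action /translate addrK.
by rewrite /shift_action /translate wm subrK addNr.
Qed.

Lemma measurable_obstruction z k : measurable (obstruction z k).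
Proof.
rewrite obstructionE; apply: bigcup_measurable => m _.
exact: measurable_digit_eq.
Qed.

(** The factor 4 ^ k.+2 in L_(k+1) covers 2 ^ k twice, once for the horizon and once for
    summability; the remaining constant 16 absorbs the successor. *)
Lemma horizon_gap k : ((horizon k).+1 * 2 ^ k <= (gap k.+1).+2)%N.
Proof.
rewrite gapE /horizon /= -gapE.
have : (0 < modprod k)%N := modprod_gt0 k.
have -> : (4 ^ k.+2 = 16 * (2 ^ k * 2 ^ k))%N.
  by rewrite -expnMn !expnS mulnA.
have : (0 < 2 ^ k)%N by rewrite expn_gt0.
move: (2 ^ k)%N (modprod k) (gap k) => a M g a0 M0.
have h1 : (a * a * g.+2 <= a * a * (M * g.+2))%N.
  by rewrite leq_mul2l leq_pmull ?orbT.
have h2 : (a <= a * a * g.+2)%N by rewrite -mulnA leq_pmulr// muln_gt0 a0.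
by move: h1 h2; rewrite -!mulnA; lia.
Qed.

(** Union bound over (horizon k).+1 residues, each of probability 1 / L_(k+1). The bound 2 ^ -k is
    written in the form summed by [epsilon_trick0]. *)
Lemma law_obstruction z k :
  (law gap R (obstruction z k) <= (2 / (2 ^ k.+1)%:R)%:E)%E.
Proof.
rewrite obstructionE bigcup_mkord.
pose A m := @digit_eq gap k.+1 (- m%:R - offset z k.+1).
have mA m : (m < (horizon k).+1)%N -> measurable (A m).
  by move=> _; exact: measurable_digit_eq.
apply: (le_trans (Boole_inequality (law gap R) mA)).
rewrite (eq_bigr (fun=> (((gap k.+1).+2)%:R^-1)%:E)) => [|m _]; last first.
  exact: law_digit_eq.
rewrite sumEFin sumr_const card_ord lee_fin.
rewrite expnS natrM [in leRHS]invfM mulrA divff ?mul1r ?pnatr_eq0//.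
rewrite -[leLHS]mulr_natl ler_pdivrMr ?ltr0n// mulrC.
rewrite ler_pdivlMr ?ltr0n ?expn_gt0//.
by rewrite -natrM ler_nat horizon_gap.
Qed.

Lemma ae_unobstructed z : {ae law gap R, forall w,
  exists K, forall k, (K <= k)%N -> unobstructed w z k}.
Proof.
(* First Borel-Cantelli lemma: the null set consists of the [w] obstructed at infinitely many
   indices. *)
exists (lim_sup_set (obstruction z)); split.
- apply: bigcapT_measurable => n; apply: bigcup_measurable => k _.
  exact: measurable_obstruction.
- apply: lim_sup_set_cvg0 => [k|]; first exact: measurable_obstruction.
  apply: le_lt_trans (ltry 2); apply: le_trans (epsilon_trick0 _ _).
    by apply: lee_nneseries => // k _; exact: law_obstruction.
  by [].
move=> w /= wz n _; apply: contrapT => nw; apply: wz.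
(* A wall of level j.+1 met within horizon [k] is also met within the longer horizon [j], so testing
   each level against the preceding horizon is enough. *)
exists n => k nk [//|j] m kj mk wjm; apply: nw.
exists j; first exact: leq_trans nk kj.
exists m => //; rewrite (leq_trans mk)// leq_mul//.
  by rewrite leq_exp2l.
have : {homo gap : a b / (a <= b)%N}.
  apply: homo_leq => // [a b c|a]; first exact: leq_trans.
  have ga : ((gap a).+2 <= horizon a)%N by rewrite leq_pmull// expn_gt0.
  rewrite -2!ltnS (leq_trans _ (horizon_gap a))//.
  by rewrite (leq_trans (leqW ga))// leq_pmulr// expn_gt0.
by move=> h; rewrite !ltnS; apply: h; exact: kj.
Qed.

End ChaseGame.

Theorem theorem2p4 (R : realType) :
  exists G : percolation_game R 3,
    [/\ oriented G,
        payoffs01 G &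
        forall z : 'rV[int]_3,
          {ae Pr G, forall w : Omega G,
            limn_sup (fun n : nat => value n z w) = 1 /\
            limn_inf (fun n : nat => value n z w) = 0}].
Proof.
exists (chase_game R); split.
- exact: chase_game_oriented.
- exact: chase_game_payoffs01.
move=> z; apply: (negligibleS _ (ae_unobstructed R z)) => w /=.
by apply: contra_not => -[K]; exact: chase_oscillates.
Qed.
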